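(* For every integer $n \geq 4$, the generalized associahedron $D^n$ of type $D_n$ is not a nestohedron; that is, $D^n$ is not combinatorially equivalent to $P_B$ for any connected building set $B$.
   Context: Polytopes are convex and considered up to combinatorial equivalence (isomorphism of face lattices). A polytope of dimension $n$ is simple if each of its vertices is contained in precisely $n$ facets. A simple polytope is called flag if any set of pairwise intersecting facets has a non-empty common intersection; the combinatorial type of a flag polytope is determined by which pairs of its facets intersect. The polytope $D^n$: the generalized associahedron $D^n$ is the $n$-dimensional simple flag polytope dual to the cluster complex of the finite type cluster algebra with Dynkin diagram $D_n$. Combinatorially it is described as follows. Take a regular $2n$-gon. The set of facets of $D^n$ is in bijection with $Diag \cup D \cup D'$ (disjoint union), where $Diag$ is the set of unordered pairs of mutually centrally symmetric diagonals of the $2n$-gon that are not diameters (a diameter is a diagonal joining two antipodal vertices), and $D$ and $D'$ are two copies of the set of the $n$ diameters, those in $D$ coloured in one colour and those in $D'$ in another colour. Two distinct facets intersect if and only if one of the following holds: (1) at least one of the two corresponds to an element of $Diag$, and no diagonal belonging to the first facet has a common interior point with a diagonal belonging to the second; (2) they correspond to two diameters of the same colour; (3) they correspond to two diameters of different colours connecting the same pair of antipodal vertices. Nestohedra: for an integer $m \ge 0$ let $[m+1]=\{1,\ldots,m+1\}$. A collection $B$ of non-empty subsets of $[m+1]$ is a connected building set on $[m+1]$ if (1) $\{i\}\in B$ for all $i\in[m+1]$ and $[m+1]\in B$; (2) if $S_1,S_2\in B$ and $S_1\cap S_2\neq\emptyset$, then $S_1\cup S_2\in B$. Let $e_1,\ldots,e_{m+1}$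 be the standard basis of $\mathbb{R}^{m+1}$, and for non-empty $S\subset[m+1]$ let $\Delta_S=\mathrm{conv}\{e_i : i\in S\}$. The nestohedron $P_B$ is the Minkowski sum $\sum_{S\in B}\Delta_S$. *)

(* Defs.v *)
From HB Require Import structures.
From mathcomp Require Import all_boot all_order all_algebra.
From mathcomp Require Import all_classical all_reals all_analysis.

Set Implicit Arguments.
Unset Strict Implicit.
Unset Printing Implicit Defensive.

Import Order.TTheory GRing.Theory Num.Theory.

Local Open Scope classical_set_scope.
Local Open Scope ring_scope.

Section Polytopes.
Variable R : realType.

Definition convex_hull d (A : set 'rV[R]_d) : set 'rV[R]_d :=
  [set x | exists k (a : 'I_k -> R) (v : 'I_k -> 'rV[R]_d),
     [/\ forall i, 0 <= a i, \sum_i a i = 1, forall i, A (v i)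
       & x = \sum_i a i *: v i]].

Definition affine_hull d (A : set 'rV[R]_d) : set 'rV[R]_d :=
  [set x | exists k (a : 'I_k -> R) (v : 'I_k -> 'rV[R]_d),
     [/\ \sum_i a i = 1, forall i, A (v i) & x = \sum_i a i *: v i]].

(* No dimension is assigned to the empty set: a facet of a 0-dimensional
   polytope, which would be empty, is therefore not a facet below. *)
Definition has_dim d (A : set 'rV[R]_d) (k : nat) : Prop :=
  exists (x : 'rV[R]_d) (U : {vspace 'rV[R]_d}),
    \dim U = k /\ affine_hull A = [set x + u | u in [set` U]].

Definition polytope d (P : set 'rV[R]_d) : Prop :=
  exists2 A : set 'rV[R]_d, finite_set A & P = convex_hull A.

Definition dotp d (u v : 'rV[R]_d) : R := \sum_i u ord0 i * v ord0 i.

(* The inequality may be strict on all of P, or an equality on all of P, so the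
   empty set and P itself are faces. *)
Definition face d (P F : set 'rV[R]_d) : Prop :=
  exists (c : 'rV[R]_d) (b : R),
    (forall x, P x -> dotp c x <= b) /\ F = P `&` [set x | dotp c x = b].

Definition faces d (P : set 'rV[R]_d) : set (set 'rV[R]_d) := [set F | face P F].

Definition facets d (P : set 'rV[R]_d) : set (set 'rV[R]_d) :=
  [set F | face P F /\ exists k, has_dim P k.+1 /\ has_dim F k].

Definition vertices d (P : set 'rV[R]_d) : set 'rV[R]_d :=
  [set v | face P [set v]].

Definition comb_equiv d e (P : set 'rV[R]_d) (Q : set 'rV[R]_e) : Prop :=
  exists phi : set 'rV[R]_d -> set 'rV[R]_e,
    set_bij (faces P) (faces Q) phi /\
    forall F G, faces P F -> faces P G -> (phi F `<=` phi G <-> F `<=` G).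

Definition simple_polytope d (n : nat) (P : set 'rV[R]_d) : Prop :=
  [/\ polytope P, has_dim P n
    & forall v, vertices P v -> ([set F | facets P F /\ F v] #= `I_n)%card].

Definition flag_polytope d (n : nat) (P : set 'rV[R]_d) : Prop :=
  simple_polytope n P /\
  forall C : set (set 'rV[R]_d), C `<=` facets P ->
    (forall F G, C F -> C G -> F `&` G !=set0) ->
    \bigcap_(F in C) F !=set0.

End Polytopes.

(* The vertices of the regular 2n-gon are indexed by 'I_n.*2 in cyclic order
   (ordS is the cyclic successor), and a diagonal is the set of its endpoints. *)
Section Diagonals.
Variable n : nat.

Definition antipode (i : 'I_n.*2) : 'I_n.*2 := iter n (@ordS n.*2) i.

Definition diagonals : {set {set 'I_n.*2}} :=
  [set [set ij.1; ij.2] | ij : 'I_n.*2 * 'I_n.*2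
     & [&& ij.1 != ij.2, ij.2 != ordS ij.1 & ij.1 != ordS ij.2]]%SET.

Definition diameters : {set {set 'I_n.*2}} :=
  [set [set i; antipode i] | i : 'I_n.*2]%SET.

Definition Diag : {set {set {set 'I_n.*2}}} :=
  [set [set a; antipode @: a]
     | a : {set 'I_n.*2} in diagonals :\: diameters]%SET.

(* The boolean is the colour of a diameter. *)
Definition typeD_label : Type :=
  ({p | p \in Diag} + bool * {a | a \in diameters})%type.

Definition label_diagonals (f : typeD_label) : {set {set 'I_n.*2}} :=
  match f with
  | inl p => val p
  | inr (_, a) => [set val a]%SET
  end.

Variable R : realType.

Definition polygon_vertex (i : 'I_n.*2) : 'rV[R]_2 :=
  let theta : R := 2 * pi * i%:R / n.*2%:R in
  \row_(j < 2) if j == ord0 then cos theta else sin theta.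

Definition diagonal_interior (a : {set 'I_n.*2}) : set 'rV[R]_2 :=
  [set x | exists i j (t : R), [/\ a = [set i; j]%SET, 0 < t < 1
     & x = (1 - t) *: polygon_vertex i + t *: polygon_vertex j]].

(* Only meant for f <> g. *)
Definition typeD_compatible (f g : typeD_label) : Prop :=
  match f, g with
  | inr (c, a), inr (c', a') => c = c' \/ (c <> c' /\ a = a')
  | _, _ => forall a b, a \in label_diagonals f -> b \in label_diagonals g ->
      diagonal_interior a `&` diagonal_interior b = set0
  end.

End Diagonals.

(* The combinatorial type of a flag polytope is determined by which pairs of
   its facets intersect, so this pins P down up to combinatorial equivalence. *)
Definition typeD_associahedron (R : realType) (n d : nat) (P : set 'rV[R]_d) :
    Prop :=
  flag_polytope n P /\
  exists phi : typeD_label n -> set 'rV[R]_d,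
    set_bij setT (facets P) phi /\
    forall f g, f <> g ->
      (phi f `&` phi g !=set0 <-> typeD_compatible R f g).

Section Nestohedra.
Variables (R : realType) (m : nat).

Definition connected_building_set (B : {set {set 'I_m.+1}}) : Prop :=
  [/\ finset.set0 \notin B,
      (forall i, [set i]%SET \in B),
      finset.setT \in B
    & forall S T, S \in B -> T \in B -> S :&: T != finset.set0 ->
        S :|: T \in B].

Definition std_simplex (S : {set 'I_m.+1}) : set 'rV[R]_m.+1 :=
  convex_hull [set delta_mx ord0 i | i in [set` S]].

Definition nestohedron (B : {set {set 'I_m.+1}}) : set 'rV[R]_m.+1 :=
  [set x | exists2 y : {set 'I_m.+1} -> 'rV[R]_m.+1,
     (forall S, S \in B -> std_simplex S (y S)) & x = \sum_(S in B) y S].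

End Nestohedra.

Arguments nestohedron R {m} B.

(* Main.v *)
Require Import Defs.
From mathcomp Require Import all_boot all_order all_algebra.
From mathcomp Require Import all_classical all_reals all_analysis.

(** Only the facets that correspond to diameters are needed. Write [X a] and
    [Y a], for [a] among the [n] diameters, for the facets of the first and of
    the second colour. Facets of one colour have a common point because the
    polytope is flag, and [X a] meets [Y b] exactly when [a = b].

    In the nestohedron of a building set [B] on [m.+1] points, every nonempty
    proper face is contained in one of the faces [mass_face R B S], with [S] a
    proper member of [B] ([proper_face_sub_mass_face]), and a family of these
    has a common point exactly when the members form a nested set
    ([mass_face_common_point]). A facet is a maximal proper face, and this
    passes through a combinatorial equivalence, as does having a common point.
    So an equivalence would turn the diameters into members [X a] and [Y a] of
    [B] such that the [X] form a nested set, the [Y] form a nested set, and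
    [X a] is compatible with [Y b] exactly when [a = b]. A complete flag of
    faces of the nestohedron has [m.+1] nonempty terms, so [m <= n]; a nested
    set of proper members has at most [m] elements. Hence [m = n] and both
    nested sets are as large as possible.

    The contradiction is now about sets. In a nested set of [m] proper members,
    each member has exactly one point outside its children, its root, and so
    does the whole set. If [X c], [X a], [X b] were strictly increasing, [Y a]
    could not be compatible with the middle one alone ([crossing_no_chain]). So
    each [X b] is either a singleton or a root together with singletons
    [X a]; in the second case [Y b] has to be the singleton of that root
    ([nonminimal_partner]). Being incompatible with [Y b], every singleton
    [X a] is joined to the root of [X b] by a member of [B], so it must be
    inside [X b] ([nonminimal_contains]). As distinct maximal members are
    disjoint, at most one [X b] is not a singleton, and likewise for the [Y].
    For the other indices both sets are singletons, and [Y a] can only be the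
    root of the whole set with respect to the [X], which leaves at most one
    such index. Altogether [n <= 3]. *)

Set Implicit Arguments.
Unset Strict Implicit.
Unset Printing Implicit Defensive.

Import Order.TTheory GRing.Theory Num.Theory.

(** * Nested sets of a connected building set *)

Section NestedSets.
Import mathcomp.boot.fintype mathcomp.boot.finset.
Local Open Scope set_scope.
Local Open Scope nat_scope.

Variables (m : nat) (B : {set {set 'I_m.+1}}).
Hypothesis hB : connected_building_set B.

(** The nested-set condition, with laminarity and the condition on disjoint
    members merged: taking [A] with two members forces them to be comparable,
    or disjoint with union outside [B], because two members of [B] that meet
    have their union in [B]. *)
Definition nested (N : {set {set 'I_m.+1}}) : Prop :=
  forall A : {set {set 'I_m.+1}},
    A \subset N -> A != set0 -> cover A \in B -> cover A \in A.

(** Nestedness of a pair. Incompatible members of [B] always have their union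
    in [B]; this is the form in which incompatibility is used. *)
Definition compatible (S T : {set 'I_m.+1}) : bool :=
  [|| S \subset T, T \subset S | S :|: T \notin B].

Lemma building_neq0 S : S \in B -> S != set0.
Proof. by case: hB => h0 _ _ _ SB; apply: contraNneq h0 => <-. Qed.

Lemma building_setU S T v :
  S \in B -> T \in B -> v \in S -> v \in T -> S :|: T \in B.
Proof.
case: hB => _ _ _ hU SB TB vS vT; apply: hU => //.
by apply/set0Pn; exists v; rewrite inE vS.
Qed.

Lemma compatibleC S T : compatible S T = compatible T S.
Proof. by rewrite /compatible setUC orbCA. Qed.

Lemma compatible_meet S T v : S \in B -> T \in B -> compatible S T ->
  v \in S -> v \in T -> (S \subset T) || (T \subset S).
Proof.
move=> SB TB + vS vT; rewrite /compatible (building_setU SB TB vS vT).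
by rewrite orbF.
Qed.

Lemma nested_compatible N S T :
  nested N -> S \in N -> T \in N -> compatible S T.
Proof.
move=> nN SN TN; rewrite /compatible orbA orbC -implybE; apply/implyP.
have coverU : cover [set S; T] = S :|: T.
  by rewrite /cover; apply/setP => v; apply/bigcupP/setUP;
    [case=> U /set2P[] ->; [left|right]
    |case=> ?; [exists S|exists T]; rewrite // !inE eqxx ?orbT].
have sSTN : [set S; T] \subset N by apply/subsetP => U /set2P[] ->.
have ST0 : [set S; T] != set0 by apply/set0Pn; exists S; rewrite !inE eqxx.
move=> UB; have := nN _ sSTN ST0; rewrite coverU.
by move=> /(_ UB)/set2P[/setUidPl ->|/setUidPr ->]; rewrite ?orbT.
Qed.

Lemma compatible_nested S T :
  S \in B -> T \in B -> compatible S T -> nested [set S; T].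
Proof.
move=> SB TB cST A sA A0 coverB.
have [/andP[SA TA]|] := boolP ((S \in A) && (T \in A)).
  have AE : A = [set S; T].
    apply/eqP; rewrite eqEsubset sA; apply/subsetP => U.
    by move=> /set2P[] ->.
  have coverE : cover A = S :|: T by rewrite AE /cover bigcup_setU !big_set1.
  move: coverB cST; rewrite coverE /compatible => ->; rewrite orbF.
  by case/orP => [/setUidPr->|/setUidPl->].
move=> nST; have [U AE] : exists U, A = [set U].
  have /set0Pn[U UA] := A0; exists U; apply/setP => W; rewrite inE.
  apply/idP/eqP => [WA|->//].
  have [/set2P UE /set2P WE] := (subsetP sA _ UA, subsetP sA _ WA).
  by case: UE WE UA WA nST => -> [] -> // -> ->.
by rewrite AE /cover big_set1 inE.
Qed.

Lemma building_bigcup W (A : {set {set 'I_m.+1}}) :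
  W \in B -> A \subset B -> (forall S, S \in A -> S :&: W != set0) ->
  W :|: cover A \in B.
Proof.
move=> WB sAB AW; rewrite /cover.
elim/big_rec: _ => [|S U SA UB]; first by rewrite setU0.
have /set0Pn[v /setIP[vS vW]] := AW _ SA.
rewrite setUCA; apply: (building_setU (v := v)) => //.
- exact: (subsetP sAB).
- by rewrite inE vW.
Qed.

(** This is where an abstract nested set becomes geometric: choosing such a
    [v] as the summand of the simplex on [W], for every [W], gives a point of
    the nestohedron that lies on all the faces indexed by [N]. If [W] were
    covered by the members of [N] that do not contain it, those that meet [W]
    would have their union in [B], and nestedness would make this union one of
    them. *)
Lemma nested_escape (N : {set {set 'I_m.+1}}) W :
  N \subset B -> nested N -> W \in B ->
  exists2 v, v \in W & forall S, S \in N -> ~~ (W \subset S) -> v \notin S.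
Proof.
move=> sNB nN WB.
pose A := [set S in N | ~~ (W \subset S) & S :&: W != set0].
have sAN : A \subset N by apply/subsetP => S; rewrite inE => /andP[].
have /subsetPn[v vW vA] : ~~ (W \subset cover A).
  apply/negP => sWA; have [A0|A0] := eqVneq A set0.
    move: sWA; rewrite A0 /cover big_set0 subset0.
    by rewrite (negbTE (building_neq0 WB)).
  have UB : cover A \in B.
    rewrite -(setUidPr sWA); apply: building_bigcup => //.
      exact: subset_trans sNB.
    by move=> S; rewrite inE => /and3P[].
  have := nN _ sAN A0 UB; rewrite inE => /and3P[_ + _].
  by rewrite sWA.
exists v => // S SN nWS; apply: contraNN vA => vS.
apply/bigcupP; exists S => //; rewrite inE SN nWS /=.
by apply/set0Pn; exists v; rewrite inE vS.
Qed.

(** In the forest of a nested set, [r S] is a point of [S] outside the children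
    of [S]. *)
Definition rooted (N : {set {set 'I_m.+1}}) (r : {set 'I_m.+1} -> 'I_m.+1) :=
  forall S, S \in N ->
    r S \in S /\ forall T, T \in N -> T \proper S -> r S \notin T.

Lemma nested_setT N : nested N -> nested (setT |: N).
Proof.
move=> nN A sA A0 coverB; have [TA|TA] := boolP (setT \in A).
  suff -> : cover A = setT by [].
  by apply/eqP; rewrite -subTset bigcup_sup.
apply: nN => //; apply/subsetP => S SA; have := subsetP sA _ SA.
by case/setU1P => // SE; rewrite -SE SA in TA.
Qed.

(** The proper sub-members of [S] cannot cover [S], since their union would be
    the member [S] of [B]. *)
Lemma nested_rooted (N : {set {set 'I_m.+1}}) :
  N \subset B -> nested N -> exists r, rooted N r.
Proof.
move=> sNB nN; pose R S := S :\: cover [set T in N | T \proper S].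
have R_neq0 S : S \in N -> R S != set0.
  move=> SN; have SB := subsetP sNB _ SN; rewrite setD_eq0.
  set A := [set T in N | _]; apply/negP => sSA.
  have AE : cover A = S.
    apply/eqP; rewrite eqEsubset sSA andbT; apply/bigcupsP => T.
    by rewrite inE => /andP[_ /proper_sub].
  have [A0|A0] := eqVneq A set0.
    by have := building_neq0 SB; rewrite -AE A0 /cover big_set0 eqxx.
  have sAN : A \subset N by apply/subsetP => T; rewrite inE => /andP[].
  by have := nN A sAN A0; rewrite AE inE properxx andbF => /(_ SB).
exists (fun S => odflt ord0 [pick v in R S]) => S SN.
case: pickP => [v /setDP[vS vA]|R0] /=; last first.
  by case/set0Pn: (R_neq0 S SN) => v; rewrite R0.
split=> // T TN TS; apply: contraNN vA => vT.
by apply/bigcupP; exists T => //; rewrite inE TN.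
Qed.

Lemma rooted_inj (N : {set {set 'I_m.+1}}) r :
  N \subset B -> nested N -> rooted N r -> {in N &, injective r}.
Proof.
move=> sNB nN rN S T SN TN rST.
have [[rS rS'] [rT rT']] := (rN _ SN, rN _ TN).
have := compatible_meet (subsetP sNB _ SN) (subsetP sNB _ TN)
  (nested_compatible nN SN TN) rS.
rewrite rST => /(_ rT) sST; apply/eqP; apply: contraTT sST => neqST.
rewrite negb_or; apply/andP; split; apply/negP => sub.
- by have := rT' S SN; rewrite properEneq neqST sub -rST rS => /(_ isT).
- by have := rS' T TN; rewrite properEneq eq_sym neqST sub rST rT => /(_ isT).
Qed.

(** Roots of distinct members are distinct, and adding the whole set keeps a
    family nested and supplies one more root. *)
Lemma card_nested (N : {set {set 'I_m.+1}}) :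
  N \subset B -> setT \notin N -> nested N -> #|N| <= m.
Proof.
move=> sNB TN nN; have [_ _ TB _] := hB.
have sTNB : setT |: N \subset B by rewrite subUset sub1set TB.
have [r rN] := nested_rooted sTNB (nested_setT nN).
have := card_in_imset (rooted_inj sTNB (nested_setT nN) rN).
rewrite cardsU1 TN add1n -ltnS => <-.
by rewrite -[X in _ <= X]card_ord max_card.
Qed.

(** With [m] members, the [m.+1] roots of the members and of the whole set
    exhaust the ground set. So each member consists of the roots of the members
    below it, and [v0], the root of the whole set, is the only point that is
    not the root of a member. *)
Lemma full_nested_rooted (N : {set {set 'I_m.+1}}) :
  N \subset B -> setT \notin N -> nested N -> #|N| = m ->
  exists r v0, [/\ rooted N r,
    forall S v, S \in N -> v \in S ->
      exists T, [/\ T \in N, T \subset S & v = r T]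
    & forall v, v != v0 -> exists2 T, T \in N & v = r T].
Proof.
move=> sNB TN nN cardN; have [_ _ TB _] := hB.
have sTNB : setT |: N \subset B by rewrite subUset sub1set TB.
have nTN := nested_setT nN; have [r rN] := nested_rooted sTNB nTN.
have r_surj v : exists2 T, T \in setT |: N & v = r T.
  suff rE : r @: (setT |: N) = setT by apply/imsetP; rewrite rE.
  apply/eqP; rewrite eqEcard subsetT cardsT card_ord.
  by rewrite (card_in_imset (rooted_inj sTNB nTN rN)) cardsU1 TN cardN /= add1n.
exists r, (r setT); split.
- move=> S SN; have [rS rS'] := rN S (setU1r _ SN); split=> // T TiN.
  exact: rS' (setU1r _ TiN).
- move=> S v SN vS; have [T TiN vE] := r_surj v; exists T.
  have [rT rT'] := rN T TiN; have SN' := setU1r setT SN.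
  have := compatible_meet (subsetP sTNB _ SN') (subsetP sTNB _ TiN)
    (nested_compatible nTN SN' TiN) vS.
  rewrite {1}vE => /(_ rT) sub.
  have sTS : T \subset S.
    apply/negPn/negP => nTS; rewrite (negbTE nTS) orbF in sub.
    by have := rT' S SN'; rewrite properE sub nTS -vE vS => /(_ isT).
  split=> //; case/setU1P: TiN => // TE.
  by move: TN; rewrite TE subTset in sTS; rewrite -(eqP sTS) SN.
- move=> v; have [T /setU1P[->|TiN] ->] := r_surj v; first by rewrite eqxx.
  by exists T.
Qed.

(** The pattern of the two monochromatic families of diameters: each family has
    a common point in the nestohedron, and diameters of different colours are
    compatible exactly when they coincide. *)
Definition crossing_clusters (n : nat) (X Y : 'I_n -> {set 'I_m.+1}) : Prop :=
  [/\ [/\ forall a, X a \in B, forall a, X a != setT, injective X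
        & nested (X @: setT)],
      [/\ forall a, Y a \in B, forall a, Y a != setT, injective Y
        & nested (Y @: setT)],
      forall a b, X a != Y b
    & forall a b, compatible (X a) (Y b) = (a == b)].

Lemma crossing_clustersC n (X Y : 'I_n -> {set 'I_m.+1}) :
  crossing_clusters X Y -> crossing_clusters Y X.
Proof.
case=> hX hY XY cXY; split=> // a b; first by rewrite eq_sym.
by rewrite compatibleC cXY eq_sym.
Qed.

Section Crossing.
Variables (n : nat) (X Y : 'I_n -> {set 'I_m.+1}).
Hypotheses (hmn : m <= n) (hXY : crossing_clusters X Y).

Let XB a : X a \in B. Proof. by case: hXY => -[]. Qed.
Let YB a : Y a \in B. Proof. by case: hXY => _ []. Qed.
Let cXY a b : compatible (X a) (Y b) = (a == b). Proof. by case: hXY. Qed.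
Let cX a b : compatible (X a) (X b).
Proof.
case: hXY => -[_ _ _ nX] _ _ _.
by apply: (nested_compatible nX); apply: imset_f.
Qed.

Lemma crossing_incompatible a b : a != b ->
  [/\ ~~ (X a \subset Y b), ~~ (Y b \subset X a) & X a :|: Y b \in B].
Proof.
move=> ab; have := cXY a b; rewrite (negbTE ab) /compatible.
by case: (X a \subset _); case: (Y b \subset _); case: (_ \in B).
Qed.

(** The partner [Y a] would have to be compatible with the middle set only.
    Containing it means containing [X c], and being contained in it means being
    contained in [X b]; being disjoint from it is impossible because [Y a] is
    already joined, through [X c], to a part of [X a]. *)
Lemma crossing_no_chain c a b : X c \proper X a -> X a \proper X b -> False.
Proof.
move=> /[dup] ca /properP[sca [v va nvc]] /[dup] ab /properP[sab [w wb nwa]].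
have ncA : c != a by apply: contraTneq ca => ->; rewrite properxx.
have nbA : b != a by apply: contraTneq ab => ->; rewrite properxx.
have [ncY _ cYB] := crossing_incompatible ncA.
have [_ nYb _] := crossing_incompatible nbA.
have := cXY a a; rewrite eqxx => /or3P[sXY|sYX|/negP[]].
- by case/negP: ncY; apply: subset_trans sXY.
- by case/negP: nYb; apply: subset_trans sab.
- have /set0Pn[u uc] := building_neq0 (XB c).
  rewrite -(setUidPl sca) -setUA; apply: (building_setU (v := u)) => //.
    exact: (subsetP sca).
  by rewrite inE uc.
Qed.

(** [m <= n] makes both families as large as a nested set can be. *)
Lemma crossing_full_rooted : exists r v0, [/\
    forall a, r a \in X a,
    forall a v, v \in X a -> exists2 b, X b \subset X a & v = r b
    & forall v, v != v0 -> exists a, v = r a].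
Proof.
case: hXY => -[_ XT injX nX] _ _ _; have [_ _ TB _] := hB.
pose N := X @: setT.
have sNB : N \subset B by apply/subsetP => _ /imsetP[a _ ->].
have TN : setT \notin N.
  by apply/imsetP => -[a _ TE]; have := XT a; rewrite -TE eqxx.
have cardN : #|N| = m.
  apply/eqP; rewrite eqn_leq (card_nested sNB TN nX) /=.
  by rewrite card_imset // cardsT card_ord.
have [r [v0 [rN memN surjN]]] := full_nested_rooted sNB TN nX cardN.
have XN a : X a \in N by apply: imset_f.
exists (r \o X), v0; split=> /=.
- by move=> a; have [] := rN _ (XN a).
- move=> a v va; have [T [/imsetP[b _ ->] sba ->]] := memN _ _ (XN a) va.
  by exists b.
- by move=> v /surjN[T /imsetP[a _ ->] ->]; exists a.
Qed.

Definition minimal_index (Z : 'I_n -> {set 'I_m.+1}) (a : 'I_n) : bool :=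
  [forall b, ~~ (Z b \proper Z a)].

Section Roots.
Variables (r : 'I_n -> 'I_m.+1).
Hypotheses (rX : forall a, r a \in X a)
  (memX : forall a v, v \in X a -> exists2 b, X b \subset X a & v = r b).

Let injX : injective X. Proof. by case: hXY => -[]. Qed.

(** A minimal member has no root below it other than its own. *)
Lemma minimal_singleton a : minimal_index X a -> X a = [set r a].
Proof.
move=> /forallP mina; apply/setP => v; rewrite inE; apply/idP/eqP => [va|->//].
have [b sba ->] := memX va; have := mina b; rewrite properEneq sba andbT negbK.
by move=> /eqP/injX ->.
Qed.

(** The sets below [X b] are minimal, hence singletons, and are incompatible
    with [Y b], so [Y b] avoids them; but [Y b] must lie inside [X b], where
    only the root of [X b] is left. *)
Lemma nonminimal_partner b : ~~ minimal_index X b -> Y b = [set r b].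
Proof.
move=> /forallPn[c]; rewrite negbK => cb.
have min_below a : X a \proper X b -> X a = [set r a].
  move=> ab; apply: minimal_singleton; apply/forallP => d; apply/negP => da.
  exact: crossing_no_chain da ab.
have notY a : X a \proper X b -> r a \notin Y b.
  move=> ab; have aneb : a != b by apply: contraTneq ab => ->; rewrite properxx.
  by have [] := crossing_incompatible aneb; rewrite (min_below _ ab) sub1set.
have cneb : c != b by apply: contraTneq cb => ->; rewrite properxx.
have sYX : Y b \subset X b.
  have := cXY b b; rewrite eqxx => /or3P[sXY|//|/negP[]].
    case/negP: (notY _ cb); apply: (subsetP sXY).
    exact: (subsetP (proper_sub cb)).
  rewrite -(setUidPl (proper_sub cb)) -setUA.
  have [_ _ cYB] := crossing_incompatible cneb.
  apply: (building_setU (v := r c)) => //.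
    exact: (subsetP (proper_sub cb)).
  by rewrite inE rX.
have /set0Pn[v vY] := building_neq0 (YB b).
have YE u : u \in Y b -> u = r b.
  move=> uY; have [a sab uE] := memX (subsetP sYX _ uY).
  have [/eqP/injX <-//|neqab] := boolP (X a == X b).
  by have := notY a; rewrite -uE uY properEneq neqab sab => /(_ isT).
apply/setP => u; rewrite inE; apply/idP/eqP => [/YE//|->].
by rewrite -(YE _ vY).
Qed.

(** [Y b], the root of [X b], is joined to the singleton [X a], so a disjoint
    [X a] would be incompatible with [X b]. *)
Lemma nonminimal_contains a b :
  minimal_index X a -> ~~ minimal_index X b -> X a \subset X b.
Proof.
move=> mina nminb; have ab : a != b by apply: contraTneq mina => ->.
have Xa := minimal_singleton mina; have Yb := nonminimal_partner nminb.
have := cX a b => /or3P[//|sba|/negP[]].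
  have /eqP := forallP mina b; rewrite properEneq sba andbT => /eqP.
  by rewrite negbK => /eqP ->.
have [_ _ XYB] := crossing_incompatible ab.
have -> : X a :|: X b = X a :|: Y b :|: X b.
  by rewrite -setUA (setUidPr (_ : Y b \subset X b)) // Yb sub1set.
by apply: (building_setU (v := r b)); rewrite // Yb !inE eqxx orbT.
Qed.

(** A set strictly below [X b] is minimal, so it also lies below [X b']. Then
    [X b] and [X b'] meet and are comparable, which creates a chain of length
    three. *)
Lemma nonminimal_unique b b' :
  ~~ minimal_index X b -> ~~ minimal_index X b' -> b = b'.
Proof.
move=> nb nb'; move/forallPn: (nb) => [a]; rewrite negbK => ab.
have mina : minimal_index X a.
  apply/forallP => d; apply/negP => da; exact: crossing_no_chain da ab.
have sab' := nonminimal_contains mina nb'.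
have := compatible_meet (XB b) (XB b') (cX b b')
  (subsetP (proper_sub ab) _ (rX a)) (subsetP sab' _ (rX a)).
apply: contraTeq => neqb.
have neqX : X b != X b' by apply: contra_neq neqb => /injX.
apply/negP => /orP[] sbb.
- by apply: (@crossing_no_chain a b b'); rewrite // properEneq neqX.
- apply: (@crossing_no_chain a b' b); last by rewrite properEneq eq_sym neqX.
  rewrite properEneq sab' andbT; apply: contraNneq nb' => eqX.
  by rewrite -(injX eqX).
Qed.

End Roots.
End Crossing.

(** At most one index has [X] nonminimal and at most one has [Y] nonminimal. At
    any other index [Y a] is a singleton different from all the singletons
    among the [X] and, by [nonminimal_partner], from the root of a nonminimal
    one; the only point left is [v0], the root of the whole set. *)
Lemma crossing_clusters_le3 n (X Y : 'I_n -> {set 'I_m.+1}) :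
  m <= n -> crossing_clusters X Y -> n <= 3.
Proof.
move=> mn hXY; have hYX := crossing_clustersC hXY.
have [r [v0 [rX memX surjX]]] := crossing_full_rooted mn hXY.
have [s [w0 [sY memY _]]] := crossing_full_rooted mn hYX.
case: (hXY) => -[_ _ injX _] [_ _ injY _] neqXY _.
pose P := [set a | ~~ minimal_index X a].
pose Q := [set a | ~~ minimal_index Y a].
pose Z := ~: (P :|: Q).
have P1 : #|P| <= 1.
  apply/card_le1_eqP => a b; rewrite !inE.
  by move=> na nb; apply: (nonminimal_unique hXY rX memX).
have Q1 : #|Q| <= 1.
  apply/card_le1_eqP => a b; rewrite !inE.
  by move=> na nb; apply: (nonminimal_unique hYX sY memY).
have YZ a : a \in Z -> Y a = [set v0].
  rewrite !inE negb_or !negbK => /andP[minXa minYa].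
  have Ya := minimal_singleton hYX sY memY minYa.
  have [<-//|/surjX[b sE]] := eqVneq (s a) v0.
  have [minb|nminb] := boolP (minimal_index X b).
    have := neqXY b a.
    by rewrite Ya (minimal_singleton hXY rX memX minb) sE eqxx.
  have Yb := nonminimal_partner hXY rX memX nminb.
  have ab : a = b by apply: injY; rewrite Ya Yb sE.
  by case/negP: nminb; rewrite -ab.
have Z1 : #|Z| <= 1.
  by apply/card_le1_eqP => a b /YZ Ya /YZ Yb; apply: injY; rewrite Ya Yb.
have := cardsC (P :|: Q); rewrite card_ord => <-.
have := leq_trans (leq_card_setU P Q).1 (leq_add P1 Q1) => PQ2.
exact: (leq_add PQ2 Z1).
Qed.

End NestedSets.

(** * Faces and combinatorial equivalence *)

Section FaceLattice.
Local Open Scope classical_set_scope.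
Local Open Scope ring_scope.
Variable R : realType.

Lemma dotpDr d (c x y : 'rV[R]_d) : dotp c (x + y) = dotp c x + dotp c y.
Proof. by rewrite -big_split; apply: eq_bigr => i _; rewrite mxE mulrDr. Qed.

Lemma dotpZr d (c x : 'rV[R]_d) a : dotp c (a *: x) = a * dotp c x.
Proof. by rewrite mulr_sumr; apply: eq_bigr => i _; rewrite mxE mulrCA. Qed.

Lemma dotpBr d (c x y : 'rV[R]_d) : dotp c (x - y) = dotp c x - dotp c y.
Proof. by rewrite -scaleN1r dotpDr dotpZr mulN1r. Qed.

Lemma dotp_sumr d I (r : seq I) (P : pred I) (c : 'rV[R]_d)
    (x : I -> 'rV[R]_d) :
  dotp c (\sum_(i <- r | P i) x i) = \sum_(i <- r | P i) dotp c (x i).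
Proof.
elim/big_rec2: _ => [|i y z _ <-]; last by rewrite dotpDr.
by rewrite /dotp big1 // => i _; rewrite mxE mulr0.
Qed.

Lemma dotp_suml d I (r : seq I) (P : pred I) (c : I -> 'rV[R]_d)
    (x : 'rV[R]_d) :
  dotp (\sum_(i <- r | P i) c i) x = \sum_(i <- r | P i) dotp (c i) x.
Proof.
rewrite /dotp exchange_big; apply: eq_bigr => j _.
by rewrite summxE mulr_suml.
Qed.

Lemma dotp0l d (x : 'rV[R]_d) : dotp 0 x = 0.
Proof. by rewrite /dotp big1 // => i _; rewrite mxE mul0r. Qed.

Lemma face_sub d (P F : set 'rV[R]_d) : face P F -> F `<=` P.
Proof. by move=> [c [b [_ ->]]] x []. Qed.

Lemma face_whole d (P : set 'rV[R]_d) : face P P.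
Proof.
exists 0, 0; split=> [x _|]; first by rewrite dotp0l.
by apply/seteqP; split=> [x Px|x []//]; rewrite /= dotp0l.
Qed.

Lemma face_empty d (P : set 'rV[R]_d) : face P set0.
Proof.
exists 0, 1; split=> [x _|]; first by rewrite dotp0l ler01.
apply/seteqP; split=> x //= -[_]; rewrite dotp0l => /eqP.
by rewrite eq_sym oner_eq0.
Qed.

(** Adding up the supporting inequalities supports the intersection; the
    intersection with [P] matters when [I] is empty. *)
Lemma face_bigcap d (I : finType) (P : set 'rV[R]_d) (F : I -> set 'rV[R]_d) :
  (forall i, face P (F i)) -> face P [set x | P x /\ forall i, F i x].
Proof.
move=> hF; have [c hc] := choice hF; have [b hb] := choice hc.
exists (\sum_i c i), (\sum_i b i); split=> [x Px|].
  by rewrite dotp_suml; apply: ler_sum => i _; have [+ _] := hb i; apply.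
apply/seteqP; split=> x [Px] /=.
  move=> Fx; split=> //; rewrite dotp_suml; apply: eq_bigr => i _.
  by have := Fx i; have [_ ->] := hb i; case.
rewrite dotp_suml => /eqP; rewrite eq_sym -subr_eq0 -sumrB => /eqP sum0.
split=> // i; have [le_cb ->] := hb i; split=> //=.
apply/eqP; rewrite eq_sym -subr_eq0; apply/eqP.
apply: (psumr_eq0P _ sum0) => // j _; rewrite subr_ge0.
by have [+ _] := hb j; apply.
Qed.

Lemma free_cons_dotp d (c v : 'rV[R]_d) (s : seq 'rV[R]_d) :
  (forall u, u \in s -> dotp c u = 0) -> dotp c v != 0 -> free s ->
  free (v :: s).
Proof.
move=> cs cv fs; rewrite free_cons fs andbT; apply: contra cv.
move=> /(@coord_span _ _ _ (in_tuple s)) ->.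
rewrite dotp_sumr big1 // => i _; rewrite dotpZr cs ?mulr0 //.
by rewrite mem_nth.
Qed.

Lemma subset_affine_hull d (A : set 'rV[R]_d) : A `<=` affine_hull A.
Proof.
move=> x Ax; exists 1%N, (fun=> 1), (fun=> x).
by split; rewrite ?big_ord1 ?scale1r.
Qed.

Lemma direction_sub d (A : set 'rV[R]_d) x (U : {vspace 'rV[R]_d}) p q :
  affine_hull A = [set x + u | u in [set` U]] -> A p -> A q -> p - q \in U.
Proof.
move=> AE /subset_affine_hull + /subset_affine_hull; rewrite AE.
move=> [u Uu <-] [v Uv <-]; rewrite opprD addrACA subrr add0r.
by rewrite rpredB.
Qed.

Lemma direction_dotp d (A : set 'rV[R]_d) x (U : {vspace 'rV[R]_d}) c b u :
  affine_hull A = [set x + u | u in [set` U]] ->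
  (forall p, A p -> dotp c p = b) -> u \in U -> dotp c u = 0.
Proof.
move=> AE cA Uu.
have aff w : w \in U -> dotp c (x + w) = b.
  move=> Uw; have : affine_hull A (x + w) by rewrite AE; exists w.
  move=> [k [a [v [a1 Av ->]]]]; rewrite dotp_sumr -[RHS]mul1r -a1 mulr_suml.
  by apply: eq_bigr => i _; rewrite dotpZr cA.
have := aff u Uu; rewrite -(aff 0 (mem0v _)) addr0 dotpDr => /eqP.
by rewrite -subr_eq0 addrAC subrr add0r => /eqP.
Qed.

Lemma free_dim_le d (s : seq 'rV[R]_d) (U : {vspace 'rV[R]_d}) :
  free s -> {subset s <= U} -> (size s <= \dim U)%N.
Proof.
by move=> /eqP <- sU; apply: dimvS; apply/span_subvP.
Qed.

(** A point of each face outside the next one gives vectors from a common base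
    point, and the functional supporting the next face separates each of them
    from the span of the later ones. *)
Lemma face_chain_dim d (P : set 'rV[R]_d) n m (K : nat -> set 'rV[R]_d) :
  has_dim P n -> (forall j, face P (K j)) ->
  (forall j, (j < m)%N -> K j.+1 `<=` K j /\ ~ K j `<=` K j.+1) ->
  K m !=set0 -> (m <= n)%N.
Proof.
move=> [x [U [dimU PE]]] Kface Kchain [x0 Kx0].
suff [s [ss fs sK]] : exists s, [/\ size s = m, free s
    & forall v, v \in s -> exists2 p, K 0%N p & v = p - x0].
  rewrite -ss -dimU; apply: free_dim_le => // v /sK[p Kp ->].
  exact: direction_sub PE (face_sub (Kface _) Kp) (face_sub (Kface _) Kx0).
elim: m K Kface Kchain Kx0 => [|m IH] K Kface Kchain Kx0.
  by exists [::]; split=> //; rewrite nil_free.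
have [j||s [ss fs sK]] := IH (K \o S) _ _ Kx0; first exact: Kface.
  by move=> j jm; apply: Kchain.
have [sub01 /existsNP[p /not_implyP[Kp nKp]]] := Kchain 0%N isT.
have K1x0 : K 1%N x0.
  have : forall j, (j <= m)%N -> K m.+1 `<=` K (m.+1 - j)%N.
    elim=> [|j IHj] jm; first by rewrite subn0.
    apply: subset_trans (IHj (ltnW jm)) _.
    have -> : (m.+1 - j = (m.+1 - j.+1).+1)%N by rewrite subnSK // ltnW.
    by have [] := Kchain (m.+1 - j.+1)%N (leq_subr _ _).
  by move/(_ m (leqnn _)); rewrite subSnn; apply.
have [c [b [cP KE]]] := Kface 1%N.
have cK q : K 1%N q -> dotp c q = b by rewrite KE => -[].
exists (p - x0 :: s); split; first by rewrite /= ss.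
- apply: (@free_cons_dotp _ c) => //.
    by move=> u /sK[q Kq ->]; rewrite dotpBr !cK // subrr.
  rewrite dotpBr (cK x0) // subr_eq0; apply/eqP => cp; apply: nKp.
  by rewrite KE; split=> //; apply: (face_sub (Kface 0%N)).
- move=> v; rewrite inE => /orP[/eqP ->|/sK[q Kq ->]]; first by exists p.
  by exists q => //; apply: sub01.
Qed.

Lemma facet_neq0 d (P F : set 'rV[R]_d) : facets P F -> F !=set0.
Proof.
move=> [_ [k [_ [x [U [_ AE]]]]]].
have : affine_hull F (x + 0) by rewrite AE; exists 0 => //=; rewrite mem0v.
move=> [[|j] [a [v [a1 Fv _]]]]; last by exists (v ord0).
by move: a1; rewrite big_ord0 => /eqP; rewrite eq_sym oner_eq0.
Qed.

Lemma facet_neq d (P F : set 'rV[R]_d) : facets P F -> F <> P.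
Proof.
move=> [_ [k [[x [U [dU PE]]] [y [W [dW FE]]]]]] FP.
rewrite FP in FE.
have sUW : (U <= W)%VS.
  apply/subvP => u Uu.
  have [w1 Ww1 E1] : [set y + u | u in [set` W]] (x + u).
    by rewrite -FE PE; exists u.
  have [w2 Ww2 E2] : [set y + u | u in [set` W]] x.
    by rewrite -FE PE; exists 0; rewrite ?addr0 //= mem0v.
  have -> : u = w1 - w2.
    by apply/(addrI x); rewrite -E1 -E2 -addrA [w2 + _]addrC subrK.
  by rewrite rpredB.
by have := dimvS sUW; rewrite dU dW ltnn.
Qed.

(** If [G] were strictly between, a point of [G] outside [F] and a point of [P]
    outside [G] would add two dimensions to the direction of [F]. *)
Lemma facet_maximal d (P F G : set 'rV[R]_d) :
  facets P F -> face P G -> F `<=` G -> G <> P -> F = G.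
Proof.
move=> fF [cG [bG [cGP GE]]] sFG GP.
have [x0 Fx0] := facet_neq0 fF.
case: fF => -[c [b [cP FE]]] [k [[x [U [dU PE]]] [y [W [dW AE]]]]].
have sGP : G `<=` P by rewrite GE => z [].
apply/seteqP; split=> // g Gg; apply: contrapT => nFg.
have [p Pp nGp] : exists2 p, P p & ~ G p.
  apply: contrapT => nP; apply: GP; apply/seteqP; split=> // p Pp.
  by apply: contrapT => nGp; apply: nP; exists p.
have cF q : F q -> dotp c q = b by rewrite FE => -[].
have cGG q : G q -> dotp cG q = bG by rewrite GE => -[].
have sWU : {subset W <= U}.
  move=> w Ww.
  have h z : z \in W -> y + z - x \in U.
    move=> Wz; have [j [a [v [a1 Fv ->]]]] : affine_hull F (y + z).
      by rewrite AE; exists z.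
    rewrite -[x]scale1r -a1 scaler_suml -sumrB; apply: rpred_sum => i _.
    rewrite -scalerBr rpredZ //.
    have /subset_affine_hull : P (v i) by apply: sGP; apply: sFG.
    by rewrite PE => -[u Uu <-]; rewrite addrAC subrr add0r.
  have -> : w = (y + w - x) - (y + 0 - x).
    by rewrite opprB addrA subrK addr0 addrAC subrr add0r.
  by rewrite rpredB ?h ?mem0v.
suff : (size [:: (p - x0)%R, (g - x0)%R & vbasis W] <= \dim U)%N.
  by rewrite /= size_tuple dU dW ltnn.
have Gx0 := sFG _ Fx0.
apply: free_dim_le => [|v]; last first.
  rewrite !inE => /or3P[/eqP ->|/eqP ->|/vbasis_mem/sWU//];
    by apply: (direction_sub PE); auto.
have cW u : u \in vbasis W -> dotp c u = 0.
  by move=> /vbasis_mem; apply: (direction_dotp AE cF).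
apply: (@free_cons_dotp _ cG).
- move=> u; rewrite inE => /orP[/eqP ->|/vbasis_mem].
    by rewrite dotpBr !cGG // subrr.
  by apply: (direction_dotp AE) => q /sFG; apply: cGG.
- rewrite dotpBr (cGG x0) // subr_eq0; apply/eqP => cp; apply: nGp.
  by rewrite GE.
- apply: (@free_cons_dotp _ c) => //; last exact: basis_free (vbasisP W).
  rewrite dotpBr (cF x0) // subr_eq0; apply/eqP => cp; apply: nFg.
  by rewrite FE; split=> //; apply: sGP.
Qed.

Section CombEquiv.
Variables (d e : nat) (P : set 'rV[R]_d) (Q : set 'rV[R]_e).
Variable phi : set 'rV[R]_d -> set 'rV[R]_e.
Hypothesis phi_bij : set_bij (faces P) (faces Q) phi.
Hypothesis phi_le : forall F G,
  faces P F -> faces P G -> (phi F `<=` phi G <-> F `<=` G).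

Lemma comb_face F : face P F -> face Q (phi F).
Proof. by case: phi_bij => + _ _; apply. Qed.

Lemma comb_inj F G : face P F -> face P G -> phi F = phi G -> F = G.
Proof. by case: phi_bij => _ + _ hF hG; apply; rewrite inE. Qed.

Lemma comb_surj G : face Q G -> exists2 F, face P F & phi F = G.
Proof. by case: phi_bij => _ _ /[apply]. Qed.

Lemma comb_whole : phi P = Q.
Proof.
have [F hF FE] := comb_surj (face_whole Q).
apply/seteqP; split.
  by apply: face_sub; apply: comb_face; apply: face_whole.
by rewrite -FE; apply/(phi_le hF (face_whole P)); apply: face_sub.
Qed.

Lemma comb_empty : phi set0 = set0.
Proof.
have [F hF FE] := comb_surj (face_empty Q).
apply/seteqP; split=> //; rewrite -FE.
by apply/(phi_le (face_empty P) hF).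
Qed.

Lemma comb_nonempty F : face P F -> (phi F !=set0 <-> F !=set0).
Proof.
move=> hF; split=> /set0P Fn0; apply/set0P; apply: contra_neq Fn0.
  by move=> ->; apply: comb_empty.
by move=> FE; apply: (comb_inj hF (face_empty P)); rewrite comb_empty.
Qed.

(** A common point is a nonempty face below all the given ones, and this is
    visible in the face lattice. *)
Lemma comb_common_point (I : finType) (F : I -> set 'rV[R]_d) :
  (forall i, face P (F i)) ->
  (exists2 x, P x & forall i, F i x) <->
  (exists2 y, Q y & forall i, phi (F i) y).
Proof.
move=> hF; pose H := [set x | P x /\ forall i, F i x].
have hH : face P H by apply: face_bigcap.
have hphiF i : face Q (phi (F i)) by apply: comb_face.
split=> [[x Px Fx]|[y Qy Fy]].
  have [y phiHy] : phi H !=set0 by apply/(comb_nonempty hH); exists x.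
  exists y; first exact: face_sub (comb_face hH) _ phiHy.
  by move=> i; move: y phiHy; apply/(phi_le hH (hF i)) => z [].
have [G hG GE] := comb_surj (face_bigcap hphiF).
have [x Gx] : G !=set0 by apply/(comb_nonempty hG); rewrite GE; exists y.
exists x; first exact: face_sub hG _ Gx.
move=> i; move: x Gx; apply/(phi_le hG (hF i)).
by rewrite GE => z [].
Qed.

(** Transporting maximality through the equivalence avoids comparing the
    dimensions of [P] and [Q]. *)
Lemma comb_facet_maximal F G : facets P F -> face Q G -> G <> Q ->
  phi F `<=` G -> phi F = G.
Proof.
move=> fF /comb_surj[H hH <-] HQ /(phi_le fF.1 hH) sFH.
rewrite -(facet_maximal fF hH sFH) // => HP.
by apply: HQ; rewrite HP comb_whole.
Qed.

Lemma comb_face_chain_dim n m (G : nat -> set 'rV[R]_e) :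
  has_dim P n -> (forall j, face Q (G j)) ->
  (forall j, (j < m)%N -> G j.+1 `<=` G j /\ ~ G j `<=` G j.+1) ->
  G m !=set0 -> (m <= n)%N.
Proof.
move=> dP hG Gchain Gm.
have /choice[K hK] : forall j, exists F, face P F /\ phi F = G j.
  by move=> j; have [F] := comb_surj (hG j); exists F.
apply: (@face_chain_dim _ P n m K) => // [j|j jm|].
- by case: (hK j).
- have [[hj Ej] [hj1 Ej1]] := (hK j, hK j.+1).
  have [s1 s2] := Gchain j jm; split.
    by apply/(phi_le hj1 hj); rewrite Ej Ej1.
  by move=> /(phi_le hj hj1); rewrite Ej Ej1.
- by have [hm Em] := hK m; apply/(comb_nonempty hm); rewrite Em.
Qed.

End CombEquiv.
End FaceLattice.

(** * Faces of a nestohedron *)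

Section NestohedronFaces.
Import mathcomp.boot.fintype mathcomp.boot.finset.
Local Open Scope ring_scope.
Local Open Scope set_scope.

Variables (R : realType) (m : nat) (B : {set {set 'I_m.+1}}).
Hypothesis hB : connected_building_set B.

Implicit Types (S T U W : {set 'I_m.+1}) (x : 'rV[R]_m.+1).

Definition indicator U : 'rV[R]_m.+1 := \row_i (i \in U)%:R.

Definition mass U x : R := dotp (indicator U) x.

Lemma massE U x : mass U x = \sum_(i in U) x ord0 i.
Proof.
rewrite big_mkcond; apply: eq_bigr => i _; rewrite mxE.
by case: (i \in U); rewrite ?mul1r ?mul0r.
Qed.

Lemma delta_coef (i j : 'I_m.+1) :
  (delta_mx ord0 i : 'rV[R]_m.+1) ord0 j = (j == i)%:R.
Proof. by rewrite mxE eqxx. Qed.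

Lemma dotp_delta (c : 'rV[R]_m.+1) i : dotp c (delta_mx ord0 i) = c ord0 i.
Proof.
rewrite /dotp (bigD1 i) //= delta_coef eqxx mulr1 big1 ?addr0 // => j ji.
by rewrite delta_coef (negbTE ji) mulr0.
Qed.

Lemma std_simplex_delta S i :
  i \in S -> std_simplex S (delta_mx ord0 i : 'rV[R]_m.+1).
Proof.
move=> iS; exists 1%N, (fun=> 1), (fun=> delta_mx ord0 i).
by split; rewrite ?big_ord1 ?scale1r // => _; exists i.
Qed.

Lemma std_simplexP S (y : 'rV[R]_m.+1) : std_simplex S y ->
  [/\ forall i, 0 <= y ord0 i, forall i, i \notin S -> y ord0 i = 0
    & \sum_i y ord0 i = 1].
Proof.
move=> [k [a [v [a_ge0 a1 vS yE]]]].
have coefE i : y ord0 i = \sum_l a l * v l ord0 i.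
  by rewrite yE summxE; apply: eq_bigr => l _; rewrite mxE.
split=> [i|i iS|].
- rewrite coefE sumr_ge0 // => l _; have [j _ <-] := vS l.
  by rewrite delta_coef mulr_ge0.
- rewrite coefE big1 // => l _; have [j /= jS <-] := vS l.
  rewrite delta_coef; case: eqP => [ij|_]; last by rewrite mulr0.
  by rewrite ij jS in iS.
- under eq_bigr do rewrite coefE; rewrite exchange_big /= -[RHS]a1.
  apply: eq_bigr => l _; rewrite -mulr_sumr; have [j _ <-] := vS l.
  rewrite (bigD1 j) //= delta_coef eqxx big1 ?addr0 ?mulr1 // => i ij.
  by rewrite delta_coef (negbTE ij).
Qed.

Lemma mass_ge0 S U (y : 'rV[R]_m.+1) : std_simplex S y -> 0 <= mass U y.
Proof. by case/std_simplexP => y0 _ _; rewrite massE sumr_ge0. Qed.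

Lemma mass_eq0 S U (y : 'rV[R]_m.+1) : std_simplex S y ->
  (mass U y = 0 <-> forall i, i \in U -> y ord0 i = 0).
Proof.
case/std_simplexP => y0 _ _; rewrite massE; split=> [|yU]; last exact: big1.
by move/psumr_eq0P => yU i iU; apply: yU.
Qed.

Lemma mass_sub S U (y : 'rV[R]_m.+1) :
  std_simplex S y -> S \subset U -> mass U y = 1.
Proof.
case/std_simplexP => _ yS <- /subsetP SU.
rewrite massE big_mkcond; apply: eq_bigr => i _; case: ifPn => // iU.
by rewrite yS //; apply: contra iU => /SU.
Qed.

Definition summands (y : {set 'I_m.+1} -> 'rV[R]_m.+1) : Prop :=
  forall S, S \in B -> std_simplex S (y S).

(** The face on which the total of the coordinates in [U] is minimal: each
    summand inside [U] contributes exactly one, and the other summands must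
    contribute nothing. Sets [U] outside [B] occur in the flag [chain_face]. *)
Definition mass_face U : set 'rV[R]_m.+1 :=
  fun x => nestohedron R B x /\ mass U x = #|[set T in B | T \subset U]|%:R.

Lemma mass_sum U y : summands y -> mass U (\sum_(S in B) y S) =
  #|[set T in B | T \subset U]|%:R
  + \sum_(S in B | ~~ (S \subset U)) mass U (y S).
Proof.
move=> yB; rewrite /mass dotp_sumr (bigID (fun S => S \subset U)) /=.
congr (_ + _); rewrite -sumr_const; under [RHS]eq_bigl do rewrite inE.
by apply: eq_bigr => S /andP[SB SU]; apply: mass_sub (yB S SB) SU.
Qed.

Lemma mass_faceP U y : summands y -> (mass_face U (\sum_(S in B) y S) <->
  forall S i, S \in B -> ~~ (S \subset U) -> i \in U -> y S ord0 i = 0).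
Proof.
move=> yB; split=> [[_]|yU].
  rewrite mass_sum // => /eqP; rewrite addrC -subr_eq0 addrK => /eqP sum0.
  move=> S i SB SU; move: i; apply/(mass_eq0 _ (yB S SB)).
  apply: (psumr_eq0P _ sum0); last by rewrite SB.
  by move=> T /andP[TB _]; apply: mass_ge0 (yB T TB).
split; first by exists y.
rewrite mass_sum // big1 ?addr0 // => S /andP[SB SU].
by apply/(mass_eq0 _ (yB S SB)) => i; apply: yU.
Qed.

Lemma mass_face_face U : face (nestohedron R B) (mass_face U).
Proof.
have dotN x : dotp (- indicator U) x = - mass U x.
  by rewrite -sumrN; apply: eq_bigr => i _; rewrite !mxE mulNr.
exists (- indicator U), (- #|[set T in B | T \subset U]|%:R).
split=> [_ [y yB ->]|].
  rewrite dotN lerN2 mass_sum // lerDl sumr_ge0 // => S /andP[SB _].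
  exact: mass_ge0 (yB S SB).
apply/seteqP; split=> x [Px xU]; split=> //=; first by rewrite dotN xU.
by apply: oppr_inj; rewrite -dotN.
Qed.

Lemma selection_point (g : {set 'I_m.+1} -> 'I_m.+1) :
  (forall S, S \in B -> g S \in S) ->
  exists2 x, nestohedron R B x & forall U, mass_face U x <->
    forall S, S \in B -> ~~ (S \subset U) -> g S \notin U.
Proof.
move=> gB; have dB : summands (fun S => delta_mx ord0 (g S)).
  by move=> S SB; apply/std_simplex_delta/gB.
exists (\sum_(S in B) delta_mx ord0 (g S)).
  by exists (fun S => delta_mx ord0 (g S)).
move=> U; split=> [/(mass_faceP _ dB) gU S SB SU|gU].
  apply/negP => /(gU _ _ SB SU); rewrite delta_coef eqxx => /eqP.
  by rewrite oner_eq0.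
apply/(mass_faceP _ dB) => S i SB SU iU; rewrite delta_coef.
by case: eqP => // iE; have := gU S SB SU; rewrite -iE iU.
Qed.

(** If the union [U] of some of the members is in [B] but is none of them, then
    the summand of the simplex on [U] must vanish on all of [U], which is
    impossible. Conversely the points of [nested_escape] select a common
    point. *)
Lemma mass_face_common_point (N : {set {set 'I_m.+1}}) : N \subset B ->
  (exists2 x, nestohedron R B x & forall S, S \in N -> mass_face S x) <->
  nested B N.
Proof.
move=> sNB; split=> [[_ [y yB ->] yN] A sAN A0 UB|nN].
  apply/negPn/negP => UA.
  have y0 i : i \in finset.cover A -> y (finset.cover A) ord0 i = 0.
    case/bigcupP => S SA iS; have /(mass_faceP _ yB) := yN S (subsetP sAN _ SA).
    apply=> //; apply: contra UA => sUS.
    suff -> : finset.cover A = S by [].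
    by apply/eqP; rewrite eqEsubset sUS; apply: bigcup_sup.
  have [_ yU /eqP] := std_simplexP (yB _ UB).
  rewrite big1 ?(eq_sym 0) ?oner_eq0 // => i _.
  by have [/y0//|/yU] := boolP (i \in finset.cover A).
have /choice[g gP] : forall W, exists v, W \in B -> v \in W /\
    forall S, S \in N -> ~~ (W \subset S) -> v \notin S.
  move=> W; have [WB|] := boolP (W \in B); last by exists ord0.
  by have [v vW vN] := nested_escape hB sNB nN WB; exists v.
have [|x Px xP] := selection_point (g := g); first by move=> S /gP[].
exists x => // S SN; apply/xP => W WB WS; have [_ gW] := gP W WB; exact: gW.
Qed.

Lemma building_max S : S \in B ->
  exists2 i, i \in S & forall j : 'I_m.+1, j \in S -> (j <= i)%N.
Proof.
move=> SB; have /set0Pn[i0 i0S] := building_neq0 hB SB.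
by case: (arg_maxnP (fun j : 'I_m.+1 => j : nat) i0S) => i iS imax; exists i.
Qed.

Lemma mass_face_proper S :
  S \in B -> S != setT -> mass_face S <> nestohedron R B.
Proof.
move=> SB ST SE; have /set0Pn[i iS] := building_neq0 hB SB.
have /choice[g gP] : forall W, exists j,
    W \in B -> j \in W /\ (i \in W -> j = i).
  move=> W; have [iW|iW] := boolP (i \in W); first by exists i.
  have [WB|] := boolP (W \in B); last by exists ord0.
  by have /set0Pn[j jW] := building_neq0 hB WB; exists j.
have [|x Px xP] := selection_point (g := g); first by move=> W /gP[].
have [_ _ TB _] := hB; have /xP/(_ _ TB) : mass_face S x by rewrite SE.
by rewrite subTset (gP _ TB).2 ?inE // iS => /(_ ST).
Qed.

(** Maximising over a Minkowski sum maximises over each summand. *)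
Lemma dotp_max_summand (c : 'rV[R]_m.+1) b y T j :
  (forall x, nestohedron R B x -> dotp c x <= b) -> summands y ->
  dotp c (\sum_(S in B) y S) = b -> T \in B -> j \in T ->
  c ord0 j <= dotp c (y T).
Proof.
move=> cP yB cy TB jT.
pose z W := if W == T then delta_mx ord0 j else y W.
have zB : summands z.
  move=> W WB; rewrite /z; case: eqP => [->|_]; last exact: yB.
  exact: std_simplex_delta.
have /cP : nestohedron R B (\sum_(S in B) z S) by exists z.
rewrite -cy !dotp_sumr (bigD1 T) //= [leRHS](bigD1 T) //= {1}/z eqxx dotp_delta.
rewrite (eq_bigr (fun W => dotp c (y W))) ?lerD2r // => W /andP[_ WT].
by rewrite /z (negbTE WT).
Qed.

(** For a supporting functional [c], let [S] be a component, with respect to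
    [B], of the set [U] where [c] is least. A summand on [T] maximises [c], so
    it vanishes on [S] when [T] leaves [U]; and it vanishes there trivially
    when [T] stays in [U] without lying in [S], for then [T] misses [S]. *)
Lemma proper_face_sub_mass_face (G : set 'rV[R]_m.+1) :
  face (nestohedron R B) G -> (G !=set0)%classic -> G <> nestohedron R B ->
  exists S, [/\ S \in B, S != setT & (G `<=` mass_face S)%classic].
Proof.
move=> [c [b [cP GE]]] [x0 Gx0] GP.
have [i0 i0min] : exists i0 : 'I_m.+1, forall j, c ord0 i0 <= c ord0 j.
  by case: (@arg_minP _ _ _ (ord0 : 'I_m.+1) xpredT (fun i => c ord0 i) isT)
    => i _ imin; exists i => j; apply: imin.
pose U := [set i | c ord0 i == c ord0 i0].
have UT : U != setT.
  apply/eqP => UT; apply: GP.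
  have cconst x : nestohedron R B x -> dotp c x = c ord0 i0 * #|B|%:R.
    move=> [y yB ->]; rewrite dotp_sumr mulr_natr -sumr_const.
    apply: eq_bigr => S SB; have [_ _ y1] := std_simplexP (yB S SB).
    rewrite -[RHS]mulr1 -y1 mulr_sumr; apply: eq_bigr => i _.
    by have : i \in U by [rewrite UT inE]; rewrite inE => /eqP ->.
  move: Gx0; rewrite GE => -[Px0 cx0]; apply/seteqP; split=> x; first by case.
  by move=> Px; split=> //=; rewrite -cx0 !cconst.
have [_ B1 _ _] := hB.
have i0P : [&& [set i0] \in B, i0 \in [set i0] & [set i0] \subset U].
  by rewrite B1 sub1set !inE !eqxx.
case: (arg_maxnP (P := fun S => [&& S \in B, i0 \in S & S \subset U])
  (fun S => #|S|) i0P) => S /and3P[SB i0S SU] Smax.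
exists S; split=> //.
  by apply: contraNneq UT => ST; rewrite -subTset -ST.
move=> x; rewrite GE => -[[y yB ->] cy].
apply/(mass_faceP _ yB) => T i TB TS iS.
have [y_ge0 yT y1] := std_simplexP (yB T TB).
have [TU|/subsetPn[j jT jU]] := boolP (T \subset U).
  apply: yT; apply: contra TS => iT.
  have SUB := building_setU hB SB TB iS iT.
  have := Smax (S :|: T); rewrite SUB inE i0S subUset SU TU => /(_ isT) cardle.
  (* [S] has maximal cardinality among the members of [B] in [U] through [i0] *)
  suff /eqP <- : S :|: T == S by apply: subsetUr.
  by rewrite eq_sym eqEcard subsetUl.
have [k kT kmax] : exists2 k, k \in T &
    forall l, l \in T -> c ord0 l <= c ord0 k.
  by case: (arg_maxP (fun l => c ord0 l) jT) => k kT kmax; exists k.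
have ck : c ord0 i < c ord0 k.
  move: (subsetP SU _ iS); rewrite inE => /eqP ->.
  apply: lt_le_trans (kmax _ jT); rewrite lt_def i0min andbT.
  by move: jU; rewrite inE.
have := dotp_max_summand cP yB cy TB kT.
rewrite -[c _ k]mulr1 -y1 mulr_sumr -subr_le0 -sumrB => sum_le0.
have term_ge0 l : 0 <= c ord0 k * y T ord0 l - c ord0 l * y T ord0 l.
  rewrite -mulrBl; have [lT|/yT ->] := boolP (l \in T); last by rewrite mulr0.
  by rewrite mulr_ge0 // subr_ge0 kmax.
have sum0 : \sum_l (c ord0 k * y T ord0 l - c ord0 l * y T ord0 l) = 0.
  by apply/eqP; rewrite eq_le sum_le0 sumr_ge0.
have /eqP : c ord0 k * y T ord0 i - c ord0 i * y T ord0 i = 0.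
  by apply: (psumr_eq0P _ sum0).
by rewrite -mulrBl mulf_eq0 subr_eq0 gt_eqF //= => /eqP.
Qed.

Definition initial_segment (k : nat) : {set 'I_m.+1} :=
  [set i : 'I_m.+1 | (i < k)%N].

(** The faces of a complete flag: the coordinate totals over longer and
    longer initial segments are minimised. *)
Definition chain_face (j : nat) : set 'rV[R]_m.+1 :=
  fun x => nestohedron R B x /\ forall k : 'I_m.+1,
    (if (k <= j)%N then mass_face (initial_segment k) else nestohedron R B) x.

Lemma chain_face_face j : face (nestohedron R B) (chain_face j).
Proof.
apply: face_bigcap => k.
by case: (k <= j)%N; [apply: mass_face_face|apply: face_whole].
Qed.

Lemma chain_face_neq0 j : (chain_face j !=set0)%classic.
Proof.
have /choice[g gP] : forall W, exists i,
    W \in B -> i \in W /\ forall l : 'I_m.+1, l \in W -> (l <= i)%N.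
  move=> W; have [WB|] := boolP (W \in B); last by exists ord0.
  by have [i iW imax] := building_max WB; exists i.
have [|x Px xP] := selection_point (g := g); first by move=> W /gP[].
exists x; split=> // k; case: ifP => // _; apply/xP => W WB /subsetPn[i iW].
rewrite !inE -!leqNgt => ki; apply: leq_trans ki _; exact: (gP W WB).2.
Qed.

(** The two faces are separated by the point that takes the largest index in
    every summand except that of the whole set, where it takes [j]. *)
Lemma chain_face_proper j : (j < m)%N ->
  (chain_face j.+1 `<=` chain_face j /\
   ~ chain_face j `<=` chain_face j.+1)%classic.
Proof.
move=> jm; have [_ _ TB _] := hB; split=> [x [Px xj]|sub].
  split=> // k; have := xj k; case: (leqP k j) => [kj|_ _ //].
  by rewrite (leq_trans kj).
have /choice[g gP] : forall W, exists i : 'I_m.+1, W \in B -> [/\ i \in W,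
    W = setT -> i = j :> nat
    & W != setT -> forall l : 'I_m.+1, l \in W -> (l <= i)%N].
  move=> W; have [->|WT] := eqVneq W setT.
    by exists (inord j) => _; split; rewrite ?inE ?inordK // ltnS ltnW.
  have [WB|] := boolP (W \in B); last by exists ord0.
  have [i iW imax] := building_max WB; exists i => _; split=> // WE.
  by rewrite WE eqxx in WT.
have [|x Px xP] := selection_point (g := g); first by move=> W /gP[].
have : chain_face j x.
  split=> // k; case: ifP => // kj; apply/xP => W WB /subsetPn[i iW].
  have [_ gT gW] := gP W WB; rewrite !inE -!leqNgt => ki.
  have [WT|WT] := eqVneq W setT; first by rewrite (gT WT).
  by apply: leq_trans ki _; apply: gW.
case/sub => _ /(_ (inord j.+1)); rewrite inordK // leqnn => /xP/(_ _ TB).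
have [_ gT _] := gP _ TB; rewrite !inE gT // ltnSn => /(_ _)/negP; apply=> //.
by apply/subsetPn; exists ord_max; rewrite !inE //= -leqNgt.
Qed.

End NestohedronFaces.
Arguments mass_face R {m} B U _.

(** * Diameters of the polygon *)

Section Diameters.
Import mathcomp.boot.fintype mathcomp.boot.finset.
Local Open Scope set_scope.
Local Open Scope nat_scope.
Variable n : nat.

Lemma half_lt_double (i : 'I_n) : i < n.*2.
Proof. by rewrite -addnn ltn_addr. Qed.

Lemma val_antipode (i : 'I_n.*2) : antipode i = (i + n) %% n.*2 :> nat.
Proof.
have iterE k : iter k (@ordS n.*2) i = (i + k) %% n.*2 :> nat.
  elim: k => [|k IH]; first by rewrite addn0 modn_small.
  by rewrite iterS /= IH -addn1 modnDml addn1 addnS.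
exact: iterE.
Qed.

Lemma diameter_subproof (i : 'I_n.*2) : [set i; antipode i] \in diameters n.
Proof. by apply/imsetP; exists i. Qed.

Definition diameter (i : 'I_n) : {a | a \in diameters n} :=
  exist (fun a : {set 'I_n.*2} => a \in diameters n) _
    (diameter_subproof (Ordinal (half_lt_double i))).

Lemma diameter_inj : injective diameter.
Proof.
move=> i j /(congr1 val)/= /setP/(_ (Ordinal (half_lt_double i))).
rewrite !inE eqxx /= => /esym/orP[/eqP/(congr1 val)/=/val_inj //|].
rewrite -val_eqE /= val_antipode /= modn_small -?addnn ?ltn_add2r //.
by move/eqP => iE; have := ltn_ord i; rewrite iE ltnNge leq_addl.
Qed.

End Diameters.

(** * Carrying the facets over to the building set *)

Section Transport.
Import mathcomp.boot.fintype mathcomp.boot.finset.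
Local Open Scope classical_set_scope.
Local Open Scope set_scope.

Variables (R : realType) (m : nat) (B : {set {set 'I_m.+1}}).
Hypothesis hB : connected_building_set B.
Variables (d : nat) (P : set 'rV[R]_d) (phi : set 'rV[R]_d -> set 'rV[R]_m.+1).
Hypothesis phi_bij : set_bij (faces P) (faces (nestohedron R B)) phi.
Hypothesis phi_le : forall F G,
  faces P F -> faces P G -> ((phi F `<=` phi G)%classic <-> (F `<=` G)%classic).

(** The image of a facet is a nonempty proper face, hence lies in a face
    [mass_face R B S]; the facet being maximal, the two are equal. *)
Lemma facet_mass_face F : facets P F ->
  exists S, [/\ S \in B, S != setT & phi F = mass_face R B S].
Proof.
move=> fF; have faceF : face P F by case: fF.
have [||S [SB ST sub]] :=
  proper_face_sub_mass_face hB (comb_face phi_bij faceF).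
- by apply/(comb_nonempty phi_bij phi_le faceF); apply: facet_neq0 fF.
- rewrite -(comb_whole phi_bij phi_le).
  by move/(comb_inj phi_bij faceF (face_whole P)); apply: facet_neq fF.
exists S; split=> //; apply: (comb_facet_maximal phi_bij phi_le fF) sub.
  exact: mass_face_face.
exact: mass_face_proper.
Qed.

Lemma common_point_nested (I : finType) (F : I -> set 'rV[R]_d)
    (S : I -> {set 'I_m.+1}) :
  (forall i, face P (F i)) -> (forall i, S i \in B) ->
  (forall i, phi (F i) = mass_face R B (S i)) ->
  (exists2 x, P x & forall i, F i x) <-> nested B (S @: setT).
Proof.
move=> faceF SB phiF.
apply: (iff_trans (comb_common_point phi_bij phi_le faceF)).
have sSB : S @: setT \subset B by apply/subsetP => _ /imsetP[i _ ->].
apply: iff_trans (mass_face_common_point R hB sSB).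
split=> -[x Px xF]; exists x => //.
  by move=> _ /imsetP[i _ ->]; rewrite -phiF.
by move=> i; rewrite phiF; apply: xF; apply: imset_f.
Qed.

Lemma facets_meet_compatible F G S T : face P F -> face P G ->
  S \in B -> T \in B -> phi F = mass_face R B S -> phi G = mass_face R B T ->
  ((F `&` G !=set0)%classic <-> compatible B S T).
Proof.
move=> faceF faceG SB TB FS GT.
have [||| to_nested of_nested] := @common_point_nested bool
  (fun b => if b then F else G) (fun b => if b then S else T); try by case.
have pairE : [set (if b then S else T) | b in setT] = [set S; T].
  apply/setP => U; rewrite !inE; apply/imsetP/orP => [[[] _ ->]|].
  - by left.
  - by right.
  - by case=> /eqP ->; [exists true|exists false].
rewrite pairE in to_nested of_nested.
split=> [[x [Fx Gx]]|/(compatible_nested SB TB)/of_nested[x Px xFG]].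
  apply: (nested_compatible (N := [set S; T])); rewrite ?inE ?eqxx ?orbT //.
  by apply: to_nested; exists x => [|[]//]; apply: face_sub faceF _ Fx.
by exists x; split; [apply: (xFG true)|apply: (xFG false)].
Qed.

(** The nestohedron has a strict chain of [m.+1] nonempty faces. *)
Lemma nestohedron_dim_le n : has_dim P n -> (m <= n)%N.
Proof.
move=> dimP.
apply: (comb_face_chain_dim phi_bij phi_le dimP (chain_face_face R B)).
  by move=> j; apply: chain_face_proper.
exact: chain_face_neq0.
Qed.

End Transport.

Theorem theorem1 (R : realType) (n : nat) (hn : (4 <= n)%N)
    (d : nat) (Dn : set 'rV[R]_d) (hDn : typeD_associahedron n Dn)
    (m : nat) (B : {set {set 'I_m.+1}}) (hB : connected_building_set B) :
  ~ comb_equiv Dn (nestohedron R B).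
Proof.
move=> [phi [phi_bij phi_le]].
have [[[_ dimD _] flagD] [psi [psi_bij psi_cap]]] := hDn.
pose lab (c : bool) (i : 'I_n) : typeD_label n := inr (c, diameter i).
have lab_inj c i c' i' : lab c i = lab c' i' -> (c = c') /\ (i = i').
  have inr_inj (p q : bool * {a | a \in diameters n}) :
    inr p = inr q :> typeD_label n -> p = q by case.
  by move=> /inr_inj E; split;
    [exact: (congr1 fst E)|exact: diameter_inj (congr1 snd E)].
pose F c i := psi (lab c i).
have facetF c i : facets Dn (F c i) by case: psi_bij => + _ _; apply.
have faceF c i : face Dn (F c i) by case: (facetF c i).
have /choice[W0 hW0] : forall p : bool * 'I_n, exists S,
    [/\ S \in B, S != finset.setT & phi (F p.1 p.2) = mass_face R B S].
  by move=> p; apply: (facet_mass_face hB phi_bij phi_le).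
pose W c i := W0 (c, i).
have hW c i : [/\ W c i \in B, W c i != finset.setT
    & phi (F c i) = mass_face R B (W c i)] by apply: (hW0 (c, i)).
have WB c i : W c i \in B by case: (hW c i).
have WT c i : W c i != finset.setT by case: (hW c i).
have phiF c i : phi (F c i) = mass_face R B (W c i) by case: (hW c i).
have W_inj c i c' i' : W c i = W c' i' -> c = c' /\ i = i'.
  move=> WE; apply: lab_inj; case: psi_bij => _ psi_inj _.
  apply: psi_inj; rewrite ?inE //.
  by apply: (comb_inj phi_bij (faceF c i) (faceF c' i')); rewrite !phiF WE.
have meetE c i c' i' : lab c i <> lab c' i' ->
    (compatible B (W c i) (W c' i') <->
     typeD_compatible R (lab c i) (lab c' i')).
  move=> neq; apply: iff_trans (psi_cap _ _ neq).
  apply: iff_sym; exact: (facets_meet_compatible hB phi_bij phi_le (faceF c i)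
    (faceF c' i') (WB c i) (WB c' i') (phiF c i) (phiF c' i')).
have nestedW c : nested B [set W c i | i in finset.setT]%SET.
  apply/(common_point_nested hB phi_bij phi_le (faceF c) (WB c) (phiF c)).
  (* flagness yields a common point of the facets, and any one of them places
     it in the polytope *)
  pose i0 : 'I_n := Ordinal (leq_trans (ltn0Sn 3) hn).
  have [||x xF] := flagD (range (F c)).
  - by move=> _ [i _ <-].
  - move=> _ _ [i _ <-] [j _ <-].
    have [<-|/eqP ij] := eqVneq i j; first by rewrite setIid; apply: facet_neq0.
    have neq : lab c i <> lab c j by move=> /lab_inj[].
    by apply/(psi_cap _ _ neq); left.
  have Fx i : F c i x by apply: xF; exists i.
  by exists x => //; apply: face_sub (faceF c i0) _ (Fx i0).
have mn : (m <= n)%N by apply: (nestohedron_dim_le hB phi_bij phi_le dimD).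
have hWW : crossing_clusters B (W false) (W true).
  split.
  - by split; [exact: WB|exact: WT|move=> i j /W_inj[]|exact: nestedW].
  - by split; [exact: WB|exact: WT|move=> i j /W_inj[]|exact: nestedW].
  - by move=> i j; apply/eqP => /W_inj[].
  - move=> i j; have neq : lab false i <> lab true j by move=> /lab_inj[].
    apply/idP/eqP => [/(meetE _ _ _ _ neq)/=|<-].
      by case=> // -[_ /diameter_inj].
    have neq' : lab false i <> lab true i by move=> /lab_inj[].
    by apply/(meetE _ _ _ _ neq'); right.
by have := crossing_clusters_le3 hB mn hWW; rewrite leqNgt hn.
Qed.
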